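(* For every positive integer $n$ there exists a constant $C(n)>0$, depending only on $n$, such that the following holds. Let $(R,\mathfrak{m})$ be a finite chain ring whose residue field $R/\mathfrak{m}$ has cardinality $q$ and such that $R$ has cardinality $q^r$. If $A\subset \mathrm{M}_n(R)$ satisfies $|A|\geq C(n)q^{rn^{2}-1}$, then $$ \max ( |A+A|,|AA| ) \geq C(n)^{-1} \min \left( \frac{|A|^{2}}{q^{rn^{2}-\frac{n+1}{4}}} ,\; q^{\frac{rn^{2}}{3}}|A|^{\frac{2}{3}} \right) . $$
   Context: A finite chain ring is a finite commutative ring with $1$ which is local and whose maximal ideal $\mathfrak{m}$ is principal (equivalently, a finite commutative ring with $1$ that is a local principal ideal ring). $\mathrm{M}_n(R)$ is the ring of $n\times n$ matrices over $R$. For $A\subset \mathrm{M}_n(R)$, $A+A=\{a+a': a,a'\in A\}$ and $AA=\{aa': a,a'\in A\}$. *)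

(* Defs.v *)
From HB Require Import structures.
From mathcomp Require Import all_boot all_order all_algebra generic_quotient ring_quotient.
From mathcomp Require Import all_classical all_reals all_analysis.

Set Implicit Arguments.
Unset Strict Implicit.
Unset Printing Implicit Defensive.

Import Order.TTheory GRing.Theory Num.Theory.

Local Open Scope ring_scope.

(* The library gives the quotient of a finite ring by an ideal no finType
   structure; this one is transported along the section [repr], so that
   [#|{: {ideal_quot m}}|] is the number of classes modulo [m]. *)
HB.instance Definition _ (R : finZmodType) (m : zmodClosed R) :
  isCountable {ideal_quot m} := CanIsCountable (@reprK R {ideal_quot m}).
HB.instance Definition _ (R : finZmodType) (m : zmodClosed R) :
  fintype.isFinite {ideal_quot m} := CanIsFinite (@reprK R {ideal_quot m}).

(* An [idealr] is proper: it does not contain 1. *)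
Definition maximal_ideal (R : comNzRingType) (m : idealr R) : Prop :=
  forall J : idealr R, {subset m <= J} -> {subset J <= m}.

Definition principal_ideal (R : comNzRingType) (m : idealr R) : Prop :=
  exists x : R, forall y : R, y \in m <-> exists a : R, y = a * x.

Definition local_ring (R : comNzRingType) (m : idealr R) : Prop :=
  maximal_ideal m /\ forall J : idealr R, maximal_ideal J -> J =i m.

Definition finite_chain_ring (R : finComNzRingType) (m : idealr R) : Prop :=
  local_ring m /\ principal_ideal m.

Definition sumset (R : finComNzRingType) (n : nat) (A : {set 'M[R]_n}) :
  {set 'M[R]_n} := [set a + b | a in A, b in A].

Definition productset (R : finComNzRingType) (n : nat) (A : {set 'M[R]_n}) :
  {set 'M[R]_n} := [set a *m b | a in A, b in A].

(* Main.v *)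
Require Import Defs.
From HB Require Import structures.
From mathcomp Require Import all_boot all_order all_algebra all_fingroup.
From mathcomp Require Import all_field all_character generic_quotient ring_quotient.
From mathcomp Require Import all_classical all_reals all_analysis.
From mathcomp Require Import ring lra zify.

Set Implicit Arguments.
Unset Strict Implicit.
Unset Printing Implicit Defensive.

Import Order.TTheory GRing.Theory Num.Theory.
Local Open Scope ring_scope.

(** Write M for the ring of n x n matrices over R, N = |M|, and let q be the
    size of the residue field.

    The sums and products of A are tied together by the identity
    (a + c) b = c b + a b.  Call a point (s, p) of M x M incident with the
    line (b, d) when s b = p + d, and let F = (A + A) x (A A).  For a, b in A
    the line (b, a b) contains all the points (a + c, c b), c in A, so it
    meets F in at least |A| points.  If b is invertible then (a, b) can be
    recovered from (b, a b), so there are about |A|^2 such lines: at most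
    n N / q matrices have a determinant in the maximal ideal
    ([card_det_in_max_ideal]), and the lower bound on |A| makes this at most
    half of A.

    On the other hand a random line meets F in |F| / N points, and the variance
    is small.  The second moment counts the triples (f, g, b) with f, g in F
    and (f.1 - g.1) b = f.2 - g.2; expanding this condition in additive
    characters psi of M, the trivial character contributes exactly the square
    of the mean.  For a nontrivial psi, summing over b leaves only pairs with
    f.1 - g.1 in the annihilator of psi, the set of d with psi (d b) = 1 for
    all b.  It is a proper right ideal of M, and these have at most N / q^n
    elements ([card_proper_right_ideal]); Schur's test
    ([sum_cayley_form_le]) and Parseval then bound the variance by
    |F| / q^n ([coincidences_bound]).

    Chebyshev's inequality ([rich_lines]) gives an alternative: either the
    mean |F| / N exceeds |A| / 2, hence |A| N < 2 |A + A| |A A|, or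
    |A|^4 q^n <= 8 N^2 |A + A| |A A|.  The two cases yield the two terms of
    the minimum; as n >= 1, the second gains q^(n/2) where q^((n+1)/4)
    suffices. *)

(** * Units of a finite local ring *)

(** Ideals are found below as maximal elements among finite sets; this packs
    such a set as a ring ideal. *)
Lemma idealr_of_set (R : finComNzRingType) (S : {set R}) :
  idealr_closed (mem S) -> exists J : idealr R, forall x, (x \in J) = (x \in S).
Proof.
case=> S0 S1 SM; pose P : pred R := fun x => x \in S.
have P_ideal : idealr_closed P by split.
pose P_isIdealr := isIdealr.Build R P P_ideal.
pose J : idealr R := HB.pack P P_isIdealr.
by exists J.
Qed.

(** If x were not a unit, a largest proper ideal containing the multiples of x
    would be maximal, hence equal to m. *)
Lemma local_ring_unit (R : finComNzRingType) (m : idealr R) (x : R) :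
  local_ring m -> x \notin m -> exists y, y * x = 1.
Proof.
move=> [_ m_uniq] xNm; suff /existsP[y /eqP] : [exists y, y * x == 1] by exists y.
apply: contraNT xNm => /existsPn xNunit.
(* Ideals as a boolean predicate on sets, so that finiteness provides a maximal
   one; 0 \in S follows from x \in S. *)
pose good (S : {set R}) := [&& x \in S, 1 \notin S &
  [forall a, forall u, forall v, (u \in S) && (v \in S) ==> (a * u + v \in S)]].
pose P0 : {set R} := [set a * x | a : R].
have P0good : good P0.
  apply/and3P; split.
  - by apply/imsetP; exists 1; rewrite ?mul1r.
  - by apply/imsetP=> -[a _ e]; move: (xNunit a); rewrite -e eqxx.
  - apply/forallP=> a; apply/forallP=> u; apply/forallP=> v; apply/implyP.
    move=> /andP[/imsetP[b _ ->] /imsetP[c _ ->]]; apply/imsetP.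
    by exists (a * b + c); rewrite // mulrDl mulrA.
have [S /maxsetP[Sgood Smax] _] := maxset_exists P0good.
have /and3P[xS S1 Scl] := Sgood.
have SclP a u v : u \in S -> v \in S -> a * u + v \in S.
  by move=> uS vS; move/forallP/(_ a)/forallP/(_ u)/forallP/(_ v): Scl; rewrite uS vS.
have S_ideal : idealr_closed (mem S).
  split=> [||a u v]; [|exact: S1|exact: SclP].
  have /= := SclP (-1) x x xS xS; rewrite mulN1r addNr; exact.
have [J JE] := idealr_of_set S_ideal.
have Jmax : maximal_ideal J.
  move=> J' JJ' y yJ'.
  have J'good : good [set z | z \in J'].
    apply/and3P; split; rewrite ?inE ?idealr1 //; first by rewrite JJ' ?JE.
    apply/forallP=> a; apply/forallP=> u; apply/forallP=> v; apply/implyP.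
    by rewrite !inE => /andP[uJ vJ]; rewrite rpredD ?idealMr.
  have JS : [set z | z \in J'] = S.
    by apply: Smax J'good _; apply/fintype.subsetP=> z zS; rewrite inE JJ' ?JE.
  by rewrite JE -JS inE.
by rewrite -(m_uniq J Jmax) JE.
Qed.

Lemma repr_inj_mod (R : finComNzRingType) (m : idealr R) (x y : {ideal_quot m}) :
  repr x - repr y \in m -> x = y.
Proof. by rewrite Quotient.idealrBE !reprK => /eqP. Qed.

(** * Counting noninvertible matrices *)

(** Expanding along the first row, the determinant is affine in the corner
    entry, with slope the complementary minor. *)
Lemma det_add_corner (R : comNzRingType) (n : nat) (b : 'M[R]_n.+1) (x : R) :
  \det (b + x *: delta_mx 0 0) = \det b + x * \det (row' 0 (col' 0 b)).
Proof.
have minorE j : row' 0 (col' j (b + x *: delta_mx 0 0)) = row' 0 (col' j b).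
  by apply/matrixP=> i k; rewrite !mxE /= mulr0 addr0.
rewrite !(expand_det_row _ 0).
under eq_bigr => j _ do rewrite /cofactor minorE -/(cofactor b 0 j) !mxE eqxx mulrDl.
rewrite big_split /=; congr (_ + _); rewrite (bigD1 0) //= big1 => [|j /negbTE ->].
  by rewrite addr0 mulr1 /cofactor expr0 mul1r.
by rewrite mulr0 mul0r.
Qed.

(** Induction on n.  When the complementary minor of the corner is a unit, the
    corner entry of a matrix whose determinant is in m is determined modulo m
    by the other entries, which costs a factor q; the remaining matrices have
    their minor in m and are counted by induction. *)
Lemma card_det_in_max_ideal (R : finComNzRingType) (m : idealr R) (n : nat) :
  local_ring m ->
  (#|[set b : 'M[R]_n | \det b \in m]| * #|{: {ideal_quot m}}|
     <= n * #|{: 'M[R]_n}|)%N.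
Proof.
move=> locR; set q := #|{: {ideal_quot m}}|.
elim: n => [|n IHn].
  rewrite (_ : [set b | _] = finset.set0) ?cards0 ?mul0n //.
  by apply/finset.setP=> b; rewrite !inE det_mx00 idealr1.
pose minor (b : 'M[R]_n.+1) := row' 0 (col' 0 b).
pose U := [set b : 'M[R]_n.+1 | \det (minor b) \in m].
pose T := [set b : 'M[R]_n.+1 | (\det b \in m) && (\det (minor b) \notin m)].
have leTU : (#|[set b : 'M[R]_n.+1 | \det b \in m]| <= #|T| + #|U|)%N.
  apply: leq_trans (leq_card_setU T U); apply/subset_leq_card/fintype.subsetP=> b.
  by rewrite !inE => ->; case: (_ \in m).
have leT : (#|T| * q <= #|{: 'M[R]_n.+1}|)%N.
  pose f (p : 'M[R]_n.+1 * {ideal_quot m}) := p.1 + repr p.2 *: delta_mx 0 0.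
  have finj : {in finset.setX T [set: _] &, injective f}.
    move=> [b x] [b' x']; rewrite !inE /= !andbT /f /=.
    move=> /andP[bm minb] /andP[b'm _] e.
    have e' : b' = b + (repr x - repr x') *: delta_mx 0 0.
      by rewrite scalerBl addrA e addrK.
    have xx' : x = x'.
      apply: repr_inj_mod; have [y yE] := local_ring_unit locR minb.
      rewrite -[_ - _]mulr1 -yE mulrCA; apply: idealMr.
      have := det_add_corner b (repr x - repr x'); rewrite -e' => /eqP.
      by rewrite addrC -subr_eq => /eqP <-; rewrite rpredB.
    by move: e; rewrite xx' => /addIr ->.
  by rewrite /q -[X in (_ * X)%N]cardsT -cardsX -(card_in_imset finj) max_card.
have leU : (#|U| * q <= n * #|{: 'M[R]_n.+1}|)%N.
  pose f (b : 'M[R]_n.+1) := (minor b, (row 0 b, col 0 (row' 0 b))).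
  have finj : injective f.
    move=> b b' [/matrixP eM /matrixP eR /matrixP eC]; apply/matrixP=> i j.
    case: (unliftP 0 i) => [i' ->|->]; last by have := eR 0 j; rewrite !mxE.
    case: (unliftP 0 j) => [j' ->|->]; last by have := eC i' 0; rewrite !mxE.
    by have := eM i' j'; rewrite !mxE.
  have leUS : (#|U| <= #|[set b : 'M[R]_n | \det b \in m]|
                       * #|{: 'rV[R]_n.+1 * 'cV[R]_n}|)%N.
    rewrite -[X in (_ * X)%N]cardsT -cardsX -(card_imset _ finj).
    apply/subset_leq_card/fintype.subsetP=> _ /imsetP[b bU ->].
    by move: bU; rewrite !inE /= => ->.
  apply: leq_trans (leq_mul leUS (leqnn q)) _.
  rewrite mulnAC; apply: leq_trans (leq_mul IHn (leqnn _)) _.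
  rewrite -mulnA leq_mul2l card_prod !card_mx -!expnD.
  by rewrite mul1n muln1 mulSn mulnS addnC addnA leqnn orbT.
apply: leq_trans (leq_mul leTU (leqnn q)) _.
by rewrite mulnDl mulSn leq_add.
Qed.

(** * Proper right ideals of a matrix ring *)

(** Some matrix unit delta_mx i i is not in B.  The q^n matrices supported on
    row i, with entries in a system of representatives modulo m, then lie in
    distinct cosets of B: a difference of two of them has a unit entry, and
    right multiplication by a multiple of a matrix unit would turn it into
    delta_mx i i. *)
Lemma card_proper_right_ideal (R : finComNzRingType) (m : idealr R) (n : nat)
    (B : {set 'M[R]_n}) :
  local_ring m ->
  {in B &, forall x y, x - y \in B} ->
  (forall x y, x \in B -> x *m y \in B) -> 1%:M \notin B ->
  (#|B| * #|{: {ideal_quot m}}| ^ n <= #|{: 'M[R]_n}|)%N.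
Proof.
move=> locR BB BM B1.
have [B0|/set0Pn[b0 b0B]] := eqVneq B finset.set0; first by rewrite B0 cards0.
have zB : 0 \in B by rewrite -(subrr b0) BB.
have BD x y : x \in B -> y \in B -> x + y \in B.
  by move=> xB yB; rewrite -[y]opprK -[- y]sub0r !BB.
have [i iNB] : exists i : 'I_n, delta_mx i i \notin B.
  apply/existsP; apply: contraNT B1 => /existsPn dB.
  rewrite -diag_const_mx diag_mx_sum_delta.
  elim/big_ind: _ => // i _; rewrite mxE scale1r.
  by move: (dB i); rewrite negbK.
pose w (x : {ffun 'I_n -> {ideal_quot m}}) : 'rV[R]_n := \row_j repr (x j).
pose f (p : 'M[R]_n * {ffun 'I_n -> {ideal_quot m}}) :=
  p.1 + delta_mx i (0 : 'I_1) *m w p.2.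
have finj : {in finset.setX B [set: _] &, injective f}.
  move=> [d x] [d' x']; rewrite !inE /= !andbT /f /= => dB d'B e.
  have {}e0 : delta_mx i (0 : 'I_1) *m (w x - w x') = d' - d.
    by rewrite mulmxBr; apply/eqP; rewrite subr_eq addrAC eq_sym subr_eq [X in _ == X]addrC e.
  have xx' : x = x'.
    apply/ffunP=> j; apply: repr_inj_mod; apply: contraNT iNB => /(local_ring_unit locR)[y yE].
    have -> : (delta_mx i i : 'M[R]_n) = (d' - d) *m (y *: delta_mx j i).
      rewrite -e0 -mulmxA -scalemxAr.
      have -> : (w x - w x') *m delta_mx j i =
         (repr (x j) - repr (x' j)) *: delta_mx (0 : 'I_1) i.
        apply/matrixP=> a b; rewrite !ord1 !mxE (bigD1 j) //= big1 ?addr0.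
          by rewrite !mxE !eqxx /=.
        by move=> k /negbTE kj; rewrite !mxE kj mulr0.
      by rewrite scalerA yE scale1r mul_delta_mx.
    by rewrite BM ?BB.
  by move: e; rewrite xx' => /addIr ->.
rewrite -[X in (_ * _ ^ X)%N](card_ord n) -card_ffun.
rewrite -[X in (_ * X)%N]cardsT -cardsX -(card_in_imset finj).
exact: max_card.
Qed.

(** * Additive characters *)

Definition unitary_character (V : finZmodType) (psi : V -> algC) : Prop :=
  {morph psi : x y / x + y >-> x * y} /\ forall x, `|psi x| = 1.

(** The irreducible characters of a finite abelian group are linear; the last
    clause is the expansion of the regular character. *)
Lemma unitary_characters_separate (V : finZmodType) :
  exists (I : finType) (i0 : I) (chi : I -> V -> algC),
    [/\ forall i, unitary_character (chi i),
        forall x, chi i0 x = 1,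
        forall i, i != i0 -> exists x, chi i x != 1 &
        forall x, \sum_i chi i x = #|V|%:R *+ (x == 0)].
Proof.
pose G := setT_group V; have abG : abelian G by apply: FinRing.Theory.zmod_abelian.
have linG i : 'chi[G]_i \is a linear_char by apply/char_abelianP.
have inG (x : V) : x \in G by apply: finset.in_setT.
exists (Iirr G), 0, (fun i x => 'chi[G]_i x); split.
- split=> [x y|x]; last exact: normC_lin_char.
  exact: (lin_charM (linG i) (inG x) (inG y)).
- by move=> x; rewrite irr0 cfun1E inG.
- move=> i i0; apply/existsP; apply: contraNT i0 => /existsPn chi1.
  rewrite -irr_eq1; apply/eqP/cfunP=> x; rewrite cfun1E inG.
  by apply/eqP; move: (chi1 x); rewrite negbK.
move=> x; have /(congr1 (fun f : 'CF(G) => f x)) := cfReg_sum G.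
rewrite cfRegE cardsT sum_cfunE => ->.
by apply: eq_bigr => i _; rewrite cfunE lin_char1 // mul1r.
Qed.

Lemma unitary_character0 (V : finZmodType) (psi : V -> algC) :
  unitary_character psi -> psi 0 = 1.
Proof.
case=> psiD psi1; have psi0 : psi 0 != 0 by rewrite -normr_eq0 psi1 oner_eq0.
by apply: (mulfI psi0); rewrite -psiD addr0 mulr1.
Qed.

Lemma unitary_characterN (V : finZmodType) (psi : V -> algC) (x : V) :
  unitary_character psi -> psi (- x) = (psi x)^*.
Proof.
move=> hpsi; have [psiD psi1] := hpsi.
have psix : psi x != 0 by rewrite -normr_eq0 psi1 oner_eq0.
apply: (mulfI psix); rewrite -psiD subrr unitary_character0 //.
by rewrite -normCK psi1 expr1n.
Qed.

Lemma sum_nontrivial_character (V : finZmodType) (psi : V -> algC) (x0 : V) :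
  {morph psi : x y / x + y >-> x * y} -> psi x0 != 1 -> \sum_x psi x = 0.
Proof.
move=> psiD psi1; apply/eqP; move: psi1; apply: contraNT => S0; apply/eqP.
apply: (mulIf S0); rewrite mul1r mulr_sumr [RHS](reindex (fun x => x0 + x)) /=.
  by apply: eq_bigr => x _; rewrite psiD.
by exists (fun x => - x0 + x) => x _; rewrite addrA ?addNr ?subrr add0r.
Qed.

(** Parseval's identity for the indicator function of P. *)
Lemma parseval (I : finType) (U : finZmodType) (chi : I -> U -> algC) (P : pred U) :
  (forall i, unitary_character (chi i)) ->
  (forall x, \sum_i chi i x = #|U|%:R *+ (x == 0)) ->
  \sum_i `|\sum_(p | P p) chi i p| ^+ 2 = #|U|%:R * #|P|%:R.
Proof.
move=> chiU chiS.
transitivity (\sum_(p | P p) \sum_(p' | P p') \sum_i chi i (p - p')).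
  rewrite exchange_big /=.
  under [RHS]eq_bigr => p _ do rewrite exchange_big.
  rewrite [RHS]exchange_big /=; apply: eq_bigr => i _.
  rewrite normCK rmorph_sum mulr_suml [RHS]exchange_big.
  apply: eq_bigr => p _.
  rewrite mulr_sumr; apply: eq_bigr => p' _.
  by rewrite (chiU i).1 unitary_characterN.
rewrite -(sum1_card P) natr_sum mulr_sumr; apply: eq_bigr => p Pp.
rewrite (bigD1 p) //= chiS subrr eqxx mulr1 big1 ?addr0 // => p' /andP[_ pp'].
by rewrite chiS subr_eq0 eq_sym (negbTE pp').
Qed.

(** Schur's test for the Cayley graph of a symmetric set B, which is regular
    of degree |B|: twice the difference of the two sides is the sum of
    the |f s - f t|^2 over its edges. *)
Lemma sum_cayley_form_le (V : finZmodType) (B : {set V}) (f : V -> algC) :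
  (forall x, (- x \in B) = (x \in B)) ->
  \sum_s \sum_(t | s - t \in B) f s * (f t)^* <= #|B|%:R * \sum_s `|f s| ^+ 2.
Proof.
move=> Bsym.
have cardB s : #|[pred t | s - t \in B]| = #|B|.
  rewrite -(fintype.card_image (inj_comp (@oppr_inj _) (addrI (- s)))) /=.
  apply: eq_card => x; rewrite inE; apply/idP/fintype.imageP => [xB|[y yB ->]].
    by exists (s - x); rewrite //= addrA addNr sub0r opprK.
  by rewrite /= opprD opprK subKr.
have cardBr s : #|[pred t | t - s \in B]| = #|B|.
  by rewrite -(cardB s); apply: eq_card => t; rewrite !inE -opprB Bsym.
have pos : 0 <= \sum_s \sum_(t | s - t \in B) `|f s - f t| ^+ 2.
  by apply: sumr_ge0 => s _; apply: sumr_ge0 => t _; rewrite exprn_ge0.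
(* The form on the left-hand side is symmetric since B is, so the sum of
   squares expands to twice the difference. *)
rewrite -subr_ge0 -(pmulr_rge0 _ (ltr0n _ 2)) //.
suff <- : \sum_s \sum_(t | s - t \in B) `|f s - f t| ^+ 2 =
          2%:R * (#|B|%:R * \sum_s `|f s| ^+ 2 -
                  \sum_s \sum_(t | s - t \in B) f s * (f t)^*) by [].
have e1 : \sum_s \sum_(t | s - t \in B) `|f s| ^+ 2 = #|B|%:R * \sum_s `|f s| ^+ 2.
  rewrite mulr_sumr; apply: eq_bigr => s _.
  by rewrite sumr_const cardB mulr_natl.
have e2 : \sum_s \sum_(t | s - t \in B) `|f t| ^+ 2 = #|B|%:R * \sum_s `|f s| ^+ 2.
  rewrite (exchange_big_dep predT) //= mulr_sumr; apply: eq_bigr => s _.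
  by rewrite sumr_const cardBr mulr_natl.
have e3 : \sum_s \sum_(t | s - t \in B) f t * (f s)^* =
          \sum_s \sum_(t | s - t \in B) f s * (f t)^*.
  rewrite (exchange_big_dep predT) //=; apply: eq_bigr => s _.
  by apply: eq_bigl => t; rewrite -opprB Bsym.
transitivity (\sum_s \sum_(t | s - t \in B) (`|f s| ^+ 2 + `|f t| ^+ 2
   - (f s * (f t)^* + f t * (f s)^*))).
  apply: eq_bigr => s _; apply: eq_bigr => t _.
  by rewrite !normCK rmorphB /=; ring.
rewrite mulrBr [2%:R * _]mulr_natl mulr2n [2%:R * _]mulr_natl mulr2n.
rewrite -{1}e1 -{1}e2 -{2}e3 -!big_split -sumrB /=; apply: eq_bigr => s _.
by rewrite -!big_split -sumrB.
Qed.

(** * Annihilators of characters *)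

(** Membership of 1 in the annihilator would make psi trivial, so this right
    ideal is proper. *)
Lemma card_annihilator (R : finComNzRingType) (m : idealr R) (n : nat)
    (psi : 'M[R]_n -> algC) :
  local_ring m -> unitary_character psi -> (exists x, psi x != 1) ->
  (#|[set d : 'M[R]_n | [forall b, psi (d *m b) == 1%R]]|
     * #|{: {ideal_quot m}}| ^ n <= #|{: 'M[R]_n}|)%N.
Proof.
move=> locR psiU [x0 x01]; have [psiD _] := psiU.
apply: card_proper_right_ideal => //.
- move=> x y; rewrite !inE => /forallP xB /forallP yB; apply/forallP=> b.
  rewrite mulmxBl psiD unitary_characterN //.
  by rewrite (eqP (xB b)) (eqP (yB b)) rmorph1 mulr1.
- move=> x y; rewrite !inE => /forallP xB; apply/forallP=> b.
  by rewrite -mulmxA.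
- by rewrite inE; apply/forallPn; exists x0; rewrite mul1mx.
Qed.

Lemma sum_pairs (T1 T2 : finType) (F : {set T1 * T2}) (G : T1 * T2 -> algC) :
  \sum_(f in F) G f = \sum_s \sum_(p | (s, p) \in F) G (s, p).
Proof.
rewrite (pair_big_dep xpredT (fun s p => (s, p) \in F) (fun s p => G (s, p))) /=.
by apply: eq_big => [[]|[]].
Qed.

(** * Incidences between points and lines *)

(** The points (s, p) of F on the line with equation s b = p + d, where
    e = (b, d). *)
Definition points_on_line (R : finComNzRingType) (n : nat)
    (F : {set 'M[R]_n * 'M[R]_n}) (e : 'M[R]_n * 'M[R]_n) :=
  [set f in F | f.1 *m e.1 == f.2 + e.2].

(** The number of pairs of points of F weighted by the number of lines through
    both: a line through f and g is determined by its slope b. *)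
Definition coincidences (R : finComNzRingType) (n : nat)
    (F : {set 'M[R]_n * 'M[R]_n}) : nat :=
  (\sum_(f in F) \sum_(g in F)
     #|[set b : 'M[R]_n | ((f.1 - g.1) *m b == f.2 - g.2)%R]|)%N.

(** Summing over b kills the pairs with f.1 - g.1 outside the annihilator of
    psi; grouping the rest by first coordinates s gives a quadratic form in
    the sums of psi over the fibres of F, to which Schur's test applies. *)
Lemma character_energy (R : finComNzRingType) (m : idealr R) (n : nat)
    (F : {set 'M[R]_n * 'M[R]_n}) (psi : 'M[R]_n -> algC) :
  local_ring m -> unitary_character psi -> (exists x, psi x != 1) ->
  (\sum_(f in F) \sum_(g in F) \sum_b psi ((f.1 - g.1) *m b - (f.2 - g.2)))
    * (#|{: {ideal_quot m}}| ^ n)%:R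
  <= #|{: 'M[R]_n}|%:R ^+ 2 * \sum_s `|\sum_(p | (s, p) \in F) psi p| ^+ 2.
Proof.
move=> locR psiU psi1; have [psiD _] := psiU.
have leB := card_annihilator locR psiU psi1.
set B := [set d | _] in leB; set N := #|{: 'M[R]_n}| in leB *.
set q := (_ ^ n)%N in leB *.
have BN x : (- x \in B) = (x \in B).
  rewrite !inE; apply: eq_forallb => b.
  by rewrite mulNmx unitary_characterN // fmorph_eq1.
(* The conjugate comes from the sign of f.2 in the argument of psi. *)
pose h s := (\sum_(p | (s, p) \in F) psi p)^*.
have sumB d : \sum_b psi (d *m b) = N%:R *+ (d \in B).
  case: (boolP (d \in B)); rewrite inE.
    move/forallP=> dB; under eq_bigr => b _ do rewrite (eqP (dB b)).
    by rewrite sumr_const mulr1n.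
  case/forallPn=> b0 psib0; rewrite mulr0n.
  by apply: (sum_nontrivial_character (x0 := b0)) => // x y; rewrite mulmxDr psiD.
have -> : \sum_(f in F) \sum_(g in F) \sum_b psi ((f.1 - g.1) *m b - (f.2 - g.2))
   = N%:R * \sum_s \sum_(t | s - t \in B) h s * (h t)^*.
  rewrite sum_pairs mulr_sumr; apply: eq_bigr => s _.
  transitivity (\sum_(p | (s, p) \in F) \sum_t \sum_(p' | (t, p') \in F)
      (N%:R *+ (s - t \in B)) * ((psi p)^* * psi p')).
    apply: eq_bigr => p _; rewrite sum_pairs; apply: eq_bigr => t _.
    apply: eq_bigr => p' _; rewrite -sumB mulr_suml; apply: eq_bigr => b _ /=.
    by rewrite psiD opprB psiD unitary_characterN // [psi p' * _]mulrC.
  rewrite exchange_big /= mulr_sumr [RHS]big_mkcond; apply: eq_bigr => t _.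
  case: ifP => _; last first.
    by rewrite big1 // => p _; rewrite big1 // => p' _; rewrite mul0r.
  rewrite /h conjCK rmorph_sum mulr_suml mulr_sumr; apply: eq_bigr => p _.
  by rewrite mulr_sumr mulr_sumr; apply: eq_bigr => p' _; rewrite mulrA.
have hE : \sum_s `|h s| ^+ 2 = \sum_s `|\sum_(p | (s, p) \in F) psi p| ^+ 2.
  by apply: eq_bigr => s _; rewrite norm_conjC.
apply: le_trans (_ : N%:R * (#|B|%:R * \sum_s `|h s| ^+ 2) * q%:R <= _).
  by rewrite ler_wpM2r ?ler0n // ler_wpM2l ?ler0n // sum_cayley_form_le.
rewrite hE expr2 -!mulrA ler_wpM2l ?ler0n // mulrA mulrAC.
rewrite -natrM ler_wpM2r ?ler_nat //.
by rewrite sumr_ge0 // => s _; rewrite exprn_ge0.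
Qed.

(** The trivial character yields the main term |F|^2, and the contributions
    of the nontrivial ones add up by Parseval on each fibre of F. *)
Lemma coincidences_bound (R : finComNzRingType) (m : idealr R) (n : nat)
    (F : {set 'M[R]_n * 'M[R]_n}) :
  local_ring m ->
  (coincidences F * #|{: {ideal_quot m}}| ^ n
     <= #|F| ^ 2 * #|{: {ideal_quot m}}| ^ n + #|{: 'M[R]_n}| ^ 2 * #|F|)%N.
Proof.
move=> locR; set q := (_ ^ n)%N; set N := #|{: 'M[R]_n}|.
have [I [i0 [chi [chiU chi0 chi1 chiS]]]] := unitary_characters_separate 'M[R]_n.
pose Y i := \sum_(f in F) \sum_(g in F) \sum_b chi i ((f.1 - g.1) *m b - (f.2 - g.2)).
have NT : N%:R * (coincidences F)%:R = \sum_i Y i.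
  rewrite /Y exchange_big natr_sum mulr_sumr; apply: eq_bigr => f _ /=.
  rewrite exchange_big natr_sum mulr_sumr; apply: eq_bigr => g _ /=.
  rewrite exchange_big -sum1_card natr_sum mulr_sumr big_mkcond /=.
  apply: eq_bigr => b _; rewrite chiS inE subr_eq0.
  by case: ifP => _; rewrite ?mulr1.
have Y0 : Y i0 = N%:R * #|F|%:R ^+ 2.
  rewrite /Y; under eq_bigr => f _ do under eq_bigr => g _ do
    under eq_bigr => b _ do rewrite chi0.
  by rewrite !sumr_const -!mulrnA -natrX -natrM -mulnn mulnA.
have Ysum : (\sum_(i | i != i0) Y i) * q%:R <= N%:R ^+ 2 * (N%:R * #|F|%:R).
  have -> : N%:R * #|F|%:R =
      \sum_i \sum_s `|\sum_(p | (s, p) \in F) chi i p| ^+ 2 :> algC.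
    rewrite exchange_big /=; under eq_bigr => s _ do rewrite parseval //.
    rewrite -mulr_sumr -[#|F|]sum1_card natr_sum sum_pairs; congr (_ * _).
    by apply: eq_bigr => s _; rewrite -sum1_card natr_sum.
  rewrite mulr_suml mulr_sumr [leRHS](bigD1 i0) //= -[leLHS]add0r.
  apply: lerD.
    by rewrite mulr_ge0 ?exprn_ge0 ?ler0n // sumr_ge0 // => s _; rewrite exprn_ge0.
  apply: ler_sum => i i_i0; exact: character_energy (chi1 i i_i0).
have N0 : 0 < N%:R :> algC by rewrite ltr0n; apply/card_gt0P; exists 0.
rewrite -(ler_nat algC) -(ler_pM2l N0) natrM mulrA NT (bigD1 i0) //= Y0.
rewrite mulrDl natrD !natrM !natrX mulrDr lerD //; first by rewrite !mulrA.
by rewrite -natrX; apply: le_trans Ysum _; rewrite expr2 mulrCA.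
Qed.

Lemma sum_points_on_line (R : finComNzRingType) (n : nat) (F : {set 'M[R]_n * 'M[R]_n}) :
  (\sum_e #|points_on_line F e| = #|F| * #|{: 'M[R]_n}|)%N.
Proof.
under eq_bigr => e _ do rewrite -sum1_card big_mkcond /=.
rewrite exchange_big /= -sum_nat_const [RHS]big_mkcond; apply: eq_bigr => f _ /=.
rewrite -big_mkcond; under eq_bigl => e do rewrite inE.
case: ifP => fF; last by rewrite big1.
pose h (b : 'M[R]_n) := (b, f.1 *m b - f.2).
have hinj : injective h by move=> b b' [].
rewrite sum1_card -(fintype.card_codom hinj); apply: eq_card => e.
apply/idP/fintype.codomP => [eF|[b ->]]; last by apply/eqP; rewrite addrC subrK.
have eE : f.1 *m e.1 = f.2 + e.2 by apply/eqP.
by exists e.1; rewrite /h eE addrC addKr; case: (e).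
Qed.

Lemma sum_points_on_line_sqr (R : finComNzRingType) (n : nat)
    (F : {set 'M[R]_n * 'M[R]_n}) :
  (\sum_e #|points_on_line F e| ^ 2 = coincidences F)%N.
Proof.
transitivity (\sum_(e : 'M[R]_n * 'M[R]_n) \sum_(f in F) \sum_(g in F)
   ((f.1 *m e.1 == f.2 + e.2)%R && (g.1 *m e.1 == g.2 + e.2)%R))%N.
  apply: eq_bigr => e _.
  have -> : #|points_on_line F e| = (\sum_(f in F) (f.1 *m e.1 == f.2 + e.2)%R)%N.
    rewrite -sum1_card big_mkcond [RHS]big_mkcond; apply: eq_bigr => f _.
    by rewrite inE; case: (f \in F); case: (_ == _).
  rewrite -mulnn big_distrl; apply: eq_bigr => f _ /=.
  by rewrite big_distrr; apply: eq_bigr => g _; rewrite /= mulnb.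
rewrite exchange_big; apply: eq_bigr => f _ /=.
rewrite exchange_big; apply: eq_bigr => g _ /=.
pose h (b : 'M[R]_n) := (b, f.1 *m b - f.2).
have hinj : injective h by move=> b b' [].
rewrite -(card_imset _ hinj) -sum1_card [RHS]big_mkcond; apply: eq_bigr => e _ /=.
case: imsetP => [[b + ->]|nex] /=.
  rewrite inE mulmxBl => /eqP eb; rewrite [f.2 + _]addrC subrK eqxx.
  have -> : g.1 *m b = f.1 *m b - (f.2 - g.2) by rewrite -eb subKr.
  by rewrite opprB addrCA eqxx.
case: eqP => //= ef; case: eqP => //= eg; case: nex; exists e.1; last first.
  by rewrite /h ef addrC addKr; case: (e).
by rewrite inE mulmxBl ef eg opprD addrACA subrr addr0.
Qed.

(** Chebyshev's inequality: the mean number of points of F on a line is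
    |F| / N, so by hypothesis a line of E exceeds it by at least k / 2. *)
Lemma rich_lines (R : finComNzRingType) (m : idealr R) (n k : nat)
    (F E : {set 'M[R]_n * 'M[R]_n}) :
  local_ring m ->
  {in E, forall e, k <= #|points_on_line F e|}%N ->
  (2 * #|F| <= k * #|{: 'M[R]_n}|)%N ->
  (#|E| * k ^ 2 * #|{: {ideal_quot m}}| ^ n <= 4 * #|{: 'M[R]_n}| ^ 2 * #|F|)%N.
Proof.
move=> locR kE Fk; have := coincidences_bound F locR.
set q := (_ ^ n)%N; set T := coincidences F; set N := #|{: 'M[R]_n}| in Fk *.
move=> Tq; have N0 : (0 < N)%N by apply/card_gt0P; exists 0.
(* The variance, scaled by N^2 to stay among the integers. *)
have var : \sum_e (N%:R * #|points_on_line F e|%:R - #|F|%:R) ^+ 2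
    = N%:R ^+ 2 * (T%:R - #|F|%:R ^+ 2) :> int.
  transitivity (N%:R ^+ 2 * (\sum_e #|points_on_line F e|%:R ^+ 2)
    - 2 * N%:R * #|F|%:R * (\sum_e #|points_on_line F e|%:R)
    + \sum_(e : 'M[R]_n * 'M[R]_n) #|F|%:R ^+ 2 : int).
    rewrite !mulr_sumr -sumrB -big_split; apply: eq_bigr => e _ /=; ring.
  rewrite -natr_sum sum_points_on_line natrM.
  under eq_bigr => e _ do rewrite -natrX.
  rewrite -natr_sum sum_points_on_line_sqr -/T sumr_const card_prod -/N -[_ *+ (N * N)]mulr_natr !natrM.
  by ring.
have lb : #|E|%:R * (N%:R * k%:R) ^+ 2 <= 4 * \sum_e (N%:R * #|points_on_line F e|%:R - #|F|%:R) ^+ 2 :> int.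
  rewrite mulr_sumr [leRHS](bigID (mem E)) /= -[leLHS]addr0 lerD //; last first.
    by apply: sumr_ge0 => e _; rewrite mulr_ge0 ?sqr_ge0.
  rewrite mulr_natl -sumr_const; apply: ler_sum => e eE.
  have : (N * k <= N * #|points_on_line F e|)%N by rewrite leq_mul2l kE ?orbT.
  move=> Nkr; rewrite (_ : 4 = 2 ^+ 2) // -exprMn -!natrM.
  have Nkr2 : (N * k + 2 * #|F| <= 2 * (N * #|points_on_line F e|))%N.
    by move: (N * #|_|)%N (N * k)%N (mulnC k N) Nkr Fk => u v ->; lia.
  have {}Nkr2 : (N * k)%:R <= 2 * ((N * #|points_on_line F e|)%:R - #|F|%:R) :> int.
    by rewrite mulrBr lerBrDr -!natrM -natrD ler_nat.
  by rewrite lerXn2r ?nnegrE // (le_trans _ Nkr2).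
have key : (#|E| * k ^ 2 + 4 * #|F| ^ 2 <= 4 * T)%N by nia.
nia.
Qed.

(** * Sums and products *)

(** The lines (b, a b), with a in A and b an invertible element of A, are
    |A|-rich in the point set (A + A) x (A A). *)
Lemma sum_product_dichotomy (R : finComNzRingType) (m : idealr R) (n : nat)
    (A : {set 'M[R]_n}) :
  local_ring m ->
  (2 * n * #|{: 'M[R]_n}| <= #|{: {ideal_quot m}}| * #|A|)%N ->
  (#|A| * #|{: 'M[R]_n}| <= 2 * (#|sumset A| * #|productset A|))%N \/
  (#|A| ^ 4 * #|{: {ideal_quot m}}| ^ n
     <= 8 * #|{: 'M[R]_n}| ^ 2 * (#|sumset A| * #|productset A|))%N.
Proof.
move=> locR; have := card_det_in_max_ideal n locR.
set q := #|{: {ideal_quot m}}|; set N := #|{: 'M[R]_n}| => sing largeA.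
have q0 : (0 < q)%N by apply/card_gt0P; exists 0.
set S := #|sumset A|; set P := #|productset A|.
pose U := [set b in A | \det b \notin m].
have AU : (#|A| <= 2 * #|U|)%N.
  have splitA : (#|A| <= #|U| + #|[set b : 'M[R]_n | \det b \in m]|)%N.
    apply: leq_trans (leq_card_setU U _); apply/subset_leq_card/fintype.subsetP=> b.
    by rewrite !inE => ->; case: (_ \in m).
  have : (2 * #|[set b : 'M[R]_n | \det b \in m]| <= #|A|)%N.
    by rewrite -(leq_pmul2l q0); apply: leq_trans largeA; rewrite -mulnA mulnCA leq_mul2l mulnC sing.
  by lia.
pose F := finset.setX (sumset A) (productset A).
have cardF : #|F| = (S * P)%N by rewrite cardsX.
have [small|] := leqP (2 * #|F|) (#|A| * N); last by rewrite cardF => /ltnW; left.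
right; pose g (x : 'M[R]_n * 'M[R]_n) := (x.2, x.1 *m x.2).
pose E := [set g x | x in finset.setX A U].
have cardE : #|E| = (#|A| * #|U|)%N.
  rewrite -cardsX card_in_imset // => -[a b] [a' b']; rewrite !inE /=.
  move=> /and3P[_ _ /(local_ring_unit locR)[y yE]] _ [<- eab]; congr (_, _).
  have inv c : c *m b *m (y *: \adj b) = c.
    by rewrite -mulmxA -scalemxAr mul_mx_adj scale_scalar_mx yE mulmx1.
  by rewrite -[a]inv eab inv.
have rich : {in E, forall e, #|A| <= #|points_on_line F e|}%N.
  move=> _ /imsetP[[a b] + ->]; rewrite !inE /= => /and3P[aA bA _].
  pose h c : 'M[R]_n * 'M[R]_n := (a + c, c *m b).
  have hinj : injective h by move=> c c' [/addrI].
  rewrite -(card_imset _ hinj); apply/subset_leq_card/fintype.subsetP.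
  move=> _ /imsetP[c cA ->]; rewrite !inE /= mulmxDl [a *m b + _]addrC eqxx andbT.
  by rewrite !imset2_f.
have := rich_lines locR rich small; rewrite cardE cardF -/q -/N => main.
apply: (@leq_trans (2 * (#|A| * #|U| * #|A| ^ 2 * q ^ n)))%N; last first.
  by move: main; set X := (_ * q ^ n)%N; lia.
rewrite !mulnA leq_mul2r; apply/orP; right.
by rewrite expnS -mulnA mulnCA !mulnA; nia.
Qed.

Theorem theorem1p13 (K : realType) (n : nat) (hn : (0 < n)%N) :
  exists C : K, 0 < C /\
    forall (R : finComNzRingType) (m : idealr R) (q r : nat),
      finite_chain_ring m ->
      #|{: {ideal_quot m}}| = q ->
      #|{: R}| = (q ^ r)%N ->
      forall A : {set 'M[R]_n},
        C * q%:R `^ ((r * n ^ 2)%:R - 1) <= #|A|%:R ->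
        C^-1 * Num.min
                 (#|A|%:R ^+ 2 / q%:R `^ ((r * n ^ 2)%:R - (n + 1)%:R / 4))
                 (q%:R `^ ((r * n ^ 2)%:R / 3) * #|A|%:R `^ (2 / 3))
          <= Num.max #|sumset A|%:R #|productset A|%:R.
Proof.
(* 2 n makes half of A invertible, and C >= 3 absorbs the constants 2 and 8
   of the dichotomy, since C^2 >= 9. *)
exists (2 * n + 1)%:R; split; first by rewrite ltr0n addn1.
move=> R m q r [locR _] qE RE A; set x := (r * n ^ 2)%:R; set C := (_ + 1)%:R => hA.
have q_ge1 : 1 <= q%:R :> K by rewrite ler1n -qE; apply/card_gt0P; exists 0.
have q0 : 0 < q%:R :> K by apply: lt_le_trans q_ge1.
have NE : #|{: 'M[R]_n}|%:R = q%:R `^ x :> K.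
  by rewrite card_mx RE -expnM natrX powR_mulrn ?ltW // mulnn.
have largeA : (2 * n * #|{: 'M[R]_n}| <= #|{: {ideal_quot m}}| * #|A|)%N.
  rewrite qE -(ler_nat K) natrM [leRHS]natrM NE.
  apply: le_trans (ler_wpM2l (ltW q0) hA).
  have qx : q%:R * q%:R `^ (x - 1) = q%:R `^ x.
    rewrite -{1}[q%:R]powRr1 ?ltW // -powRD ?(gt_eqF q0) ?implybT //.
    by rewrite addrC subrK.
  rewrite mulrCA qx.
  by rewrite ler_wpM2r ?powR_ge0 // ler_nat leq_addr.
set M := Num.max _ _; set mn := Num.min _ _.
have C3 : 3 <= C by rewrite ler_nat; lia.
have M0 : 0 <= M by rewrite le_max ler0n.
have C0 : 0 <= C by rewrite ler0n.
rewrite mulrC ler_pdivrMr ?(lt_le_trans _ C3) //.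
have SP : (#|sumset A| * #|productset A|)%:R <= M ^+ 2.
  by rewrite natrM expr2 ler_pM // le_max lexx ?orbT.
have a0 : 0 <= #|A|%:R :> K by [].
have N0 : 0 < q%:R `^ x :> K by rewrite powR_gt0.
case: (sum_product_dichotomy locR largeA).
- rewrite -(ler_nat K) natrM [leRHS]natrM NE => h1.
  apply: le_trans (_ : q%:R `^ (x / 3) * #|A|%:R `^ (2 / 3) <= _).
    by rewrite ge_min lexx orbT.
  (* With q^x = u^3 and |A| = v^3, the trivial bound v <= u gives
     (u v^2)^2 <= u^3 v^3 = q^x |A|. *)
  have uE : (q%:R `^ (x / 3)) ^+ 3 = q%:R `^ x.
    by rewrite -powR_mulrn ?powR_ge0 // -powRrM divfK.
  have vE : (#|A|%:R `^ 3^-1) ^+ 3 = #|A|%:R :> K.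
    by rewrite -powR_mulrn ?powR_ge0 // -powRrM mulVf // powRr1.
  have v2E : #|A|%:R `^ (2 / 3) = (#|A|%:R `^ 3^-1) ^+ 2 :> K.
    by rewrite -powR_mulrn ?powR_ge0 // -powRrM mulrC.
  rewrite v2E.
  have u0 : 0 <= q%:R `^ (x / 3) :> K by rewrite powR_ge0.
  have v0 : 0 <= #|A|%:R `^ 3^-1 :> K by rewrite powR_ge0.
  have AN : #|A|%:R <= q%:R `^ x :> K by rewrite -NE ler_nat max_card.
  move: uE vE u0 v0; set u := q%:R `^ (x / 3); set v := #|A|%:R `^ 3^-1 => uE vE u0 v0.
  have vu : v <= u by rewrite -(ler_pXn2r (_ : (0 < 3)%N)) ?nnegrE // uE vE.
  rewrite -(ler_pXn2r (_ : (0 < 2)%N)) ?nnegrE ?mulr_ge0 ?exprn_ge0 ?ler0n //.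
  have -> : (u * v ^+ 2) ^+ 2 = u ^+ 2 * v ^+ 3 * v by ring.
  apply: le_trans (_ : u ^+ 2 * v ^+ 3 * u <= _).
    by rewrite ler_wpM2l // mulr_ge0 ?exprn_ge0.
  have -> : u ^+ 2 * v ^+ 3 * u = v ^+ 3 * u ^+ 3 by ring.
  rewrite uE vE; apply: le_trans h1 _; nra.
rewrite qE -(ler_nat K) natrM [leRHS]natrM [(8 * _)%:R]natrM !natrX NE => h2.
apply: le_trans (_ : #|A|%:R ^+ 2 / q%:R `^ (x - (n + 1)%:R / 4) <= _).
  by rewrite ge_min lexx.
rewrite powRB; last by rewrite (gt_eqF q0) implybT.
set w := q%:R `^ ((n + 1)%:R / 4).
have w0 : 0 < w by rewrite powR_gt0.
(* This is (n + 1) / 2 <= n. *)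
have w2 : w ^+ 2 <= q%:R ^+ n.
  rewrite /w -!powR_mulrn ?powR_ge0 ?(ltW q0) // -powRrM; apply: ler_powR => //.
  have : 1 <= n%:R :> K by rewrite ler1n.
  by rewrite natrD; lra.
rewrite invf_div mulrA ler_pdivrMr //.
rewrite -(ler_pXn2r (_ : (0 < 2)%N)) ?nnegrE ?mulr_ge0 ?exprn_ge0 ?powR_ge0 //.
apply: le_trans (_ : #|A|%:R ^+ 4 * q%:R ^+ n <= _).
  by rewrite exprMn -exprM ler_wpM2l ?exprn_ge0.
apply: le_trans h2 _.
rewrite !exprMn [leRHS]mulrC; set N2 := (q%:R `^ x) ^+ 2.
have N20 : 0 <= N2 by rewrite exprn_ge0 ?ltW.
rewrite [8 * _]mulrC -mulrA ler_wpM2l //.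
have C8 : 8 <= C ^+ 2 by nra.
apply: le_trans (_ : 8 * M ^+ 2 <= _); first by rewrite ler_wpM2l.
by rewrite mulrC ler_wpM2l ?exprn_ge0.
Qed.
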